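(* There exists a universal constant $C>0$ such that for every irreducible lazy Markov chain on a finite state space, $$t_{\mathrm H}\le C\, t_{\mathrm I}.$$
   Context: All chains are in discrete time. A chain is lazy if its transition matrix has the form $(P+I)/2$ for some stochastic matrix $P$, where $I$ is the identity matrix. Let $\pi$ be the stationary distribution. Reversibility is not assumed. Hitting time of large sets: for a set $A$ of states, $\tau_A=\inf\{t\ge 0: X_t\in A\}$, and $t_{\mathrm H}=\max_{x,\,A:\,\pi(A)\ge 1/8}\mathbb{E}_x[\tau_A]$, where $\mathbb{E}_x$ is expectation for the chain $X$ started from $X_0=x$. Intersection time: let $X,Y$ be two independent chains with the given (lazy) transition matrix and let $\tau_I=\inf\{t\ge 0:\{X_0,\ldots,X_t\}\cap\{Y_0,\ldots,Y_t\}\ne\varnothing\}$. Then $t_{\mathrm I}=\max_{x,y}\mathbb{E}_{x,y}[\tau_I]$, where $\mathbb{E}_{x,y}$ is expectation when $X_0=x$, $Y_0=y$. *)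

(* Defs.v *)
From HB Require Import structures.
From mathcomp Require Import all_boot all_order all_algebra.
From mathcomp Require Import all_classical all_reals all_analysis.

Set Implicit Arguments.
Unset Strict Implicit.
Unset Printing Implicit Defensive.

Import Order.TTheory GRing.Theory Num.Theory.
Import numFieldNormedType.Exports.

Local Open Scope classical_set_scope.
Local Open Scope ring_scope.

Section TransitionMatrices.
Context {R : realType} {S : finType}.
Implicit Types (P : S -> S -> R) (pi : S -> R).

Definition stochastic P : Prop :=
  (forall x y, 0 <= P x y) /\ (forall x, \sum_(y : S) P x y = 1).

Fixpoint nstep P (n : nat) (x y : S) : R :=
  if n is m.+1 then \sum_(z : S) P x z * nstep P m z y else (x == y)%:R.

Definition irreducible P : Prop := forall x y, exists n, 0 < nstep P n x y.

Definition lazy_matrix P : Prop :=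
  exists2 Q : S -> S -> R,
    stochastic Q & forall x y, P x y = (Q x y + (x == y)%:R) / 2.

Definition stationary_distribution P pi : Prop :=
  [/\ forall x, 0 <= pi x,
      \sum_(x : S) pi x = 1
    & forall y, \sum_(x : S) pi x * P x y = pi y].

End TransitionMatrices.

Section Chains.
Context {R : realType} {S : finType} {d : measure_display}
  {Omega : measurableType d}.
Implicit Types (P : S -> S -> R) (mu : probability Omega R)
  (X Y : nat -> Omega -> S).

Definition cylinder X (n : nat) (w : nat -> S) : set Omega :=
  [set o | forall i, (i <= n)%N -> X i o = w i].

(* The Markov property is written in product form, so that no conditioning on
   null events occurs: it says that, given {X_0 = w 0, ..., X_n = w n}, the
   probability of {X_(n+1) = w (n+1)} is P (w n) (w (n+1)). *)
Definition markov_chain mu P (x : S) X : Prop :=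
  [/\ forall n s, measurable (X n @^-1` [set s]),
      mu (X 0%N @^-1` [set x]) = 1%E
    & forall n w, mu (cylinder X n.+1 w)
                  = (mu (cylinder X n w) * (P (w n) (w n.+1))%:E)%E].

Definition sigma_process X : set (set Omega) :=
  <<s [set E | exists n s, E = X n @^-1` [set s]] >>.

Definition independent_processes mu X Y : Prop :=
  forall E F, sigma_process X E -> sigma_process Y F ->
    mu (E `&` F) = (mu E * mu F)%E.

(* Both random times take values in the extended reals and are +oo, the
   infimum of the empty set, when the event never occurs. *)
Definition hitting_time X (A : {set S}) (o : Omega) : \bar R :=
  ereal_inf [set t%:R%:E | t in [set t : nat | X t o \in A]].

Definition intersection_time X Y (o : Omega) : \bar R :=
  ereal_inf [set t%:R%:E | t in [set t : nat |
    ((X^~ o @` `I_t.+1) `&` (Y^~ o @` `I_t.+1)) !=set0]].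

Definition tH (Pr : S -> probability Omega R) X (pi : S -> R) : \bar R :=
  \big[maxe/-oo%E]_(xA : S * {set S} | 1 / 8 <= \sum_(a in xA.2) pi a)
    (\int[Pr xA.1]_o hitting_time X xA.2 o)%E.

Definition tI (Pr : S -> S -> probability Omega R) X Y : \bar R :=
  \big[maxe/-oo%E]_(xy : S * S)
    (\int[Pr xy.1 xy.2]_o intersection_time X Y o)%E.

End Chains.

(* Main.v *)
(* Suppose that A has stationary measure at least 1/8 and that the chain from x
   hits A with tiny probability by time 13 t, where t is of order t_I. Let D be
   the set of points from which A is hit within time 12 t with probability at
   most 1/64. By the Markov property the chain from x probably stays in D up to
   time t, so that the chain from any y, which probably meets its trajectory by
   time t, must enter D and then avoid A for a further time 12 t. Then the
   expected proportion of time spent in A up to time 13 t is below 1/8 from every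
   starting point, which contradicts stationarity. Hence A is hit by time 13 t
   with probability bounded below from every x, and t_H is of order at most t. *)
Require Import Defs.
From HB Require Import structures.
From mathcomp Require Import all_boot all_order all_algebra.
From mathcomp Require Import all_classical all_reals all_analysis.
From mathcomp Require Import measurable_realfun ring lra.

Set Implicit Arguments.
Unset Strict Implicit.
Unset Printing Implicit Defensive.

Import Order.TTheory GRing.Theory Num.Theory.
Import numFieldNormedType.Exports.

Local Open Scope classical_set_scope.
Local Open Scope ring_scope.

(** * Avoidance probabilities and expected visit counts as functions of the starting state *)

Section TransitionOperator.
Context {R : realType} {S : finType} (P : S -> S -> R).
Implicit Types (A B D : {set S}) (f g : S -> R).

Definition step f x : R := \sum_z P x z * f z.

(* The probability that the chain from x is outside B at all times 0, ..., n. *)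
Fixpoint avoid B n x : R :=
  if n is m.+1 then (x \notin B)%:R * step (avoid B m) x else (x \notin B)%:R.

(* The expected number of times 0 <= k < n at which the chain is in A. *)
Fixpoint visits A n x : R :=
  if n is m.+1 then (x \in A)%:R + step (visits A m) x else 0.

Hypothesis stochP : stochastic P.

Lemma step_mono f g x : (forall z, f z <= g z) -> step f x <= step g x.
Proof.
by move=> fg; apply: ler_sum => z _; rewrite ler_wpM2l ?fg//; case: stochP.
Qed.

(** Rows of [P] have mass one, so constants pass through [step]; the inductions below use this to
    turn affine inequalities into pointwise ones. *)
Lemma step_affine a b f x : step (fun z => a * f z + b) x = a * step f x + b.
Proof.
rewrite /step; under eq_bigr do rewrite mulrDr.
rewrite big_split/= -mulr_suml (proj2 stochP) mul1r mulr_sumr; congr (_ + _).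
by apply: eq_bigr => z _; ring.
Qed.

Lemma step_cst c x : step (fun=> c) x = c.
Proof.
rewrite -[RHS]add0r -(mul0r (step (fun=> 0) x)) -step_affine.
by apply: eq_bigr => z _; rewrite mul0r add0r.
Qed.

Lemma step_sum n (f : nat -> S -> R) x :
  step (fun z => \sum_(k < n) f k z) x = \sum_(k < n) step (f k) x.
Proof.
rewrite /step exchange_big/=; apply: eq_bigr => z _.
by rewrite mulr_sumr.
Qed.

Lemma avoid_in B n x : x \in B -> avoid B n x = 0.
Proof. by case: n => [|n] /= ->; rewrite ?mul0r. Qed.

Lemma avoidS_notin B n x : x \notin B -> avoid B n.+1 x = step (avoid B n) x.
Proof. by move=> /= ->; rewrite mul1r. Qed.

Lemma avoid_ge0 B n x : 0 <= avoid B n x.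
Proof.
elim: n x => [|n IH] x; first by rewrite ler0n.
by rewrite /= mulr_ge0// -(step_cst 0 x) step_mono.
Qed.

Lemma avoid_le1 B n x : avoid B n x <= 1.
Proof.
elim: n x => [|n IH] x; first by rewrite /= lern1 leq_b1.
have [xB|xB] := boolP (x \in B); first by rewrite avoid_in.
by rewrite avoidS_notin// -(step_cst 1 x) step_mono.
Qed.

Lemma avoidS_le B n x : avoid B n.+1 x <= avoid B n x.
Proof.
elim: n x => [|n IH] x; have [xB|xB] := boolP (x \in B).
- by rewrite !avoid_in.
- rewrite avoidS_notin//= xB -[leRHS](step_cst 1 x).
  by apply: step_mono => z; rewrite lern1 leq_b1.
- by rewrite !avoid_in.
- by rewrite !avoidS_notin// step_mono.
Qed.

Lemma avoid_addl_le B m n x : avoid B (m + n) x <= avoid B n x.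
Proof. by elim: m => // m; apply: le_trans; rewrite addSn avoidS_le. Qed.

(* A bound for the hitting probability of A from outside D transfers to points
   from which D is likely to be left. *)
Lemma exit_hit A D (delta : R) s T x : delta <= 1 ->
    (forall z, z \notin D -> delta <= 1 - avoid A T z) ->
  (1 - avoid (~: D) s x) * delta <= 1 - avoid A (s + T) x.
Proof.
move=> d1 dD; elim: s x => [|s IH] x.
  have [xD|xD] := boolP (x \in D).
    by rewrite /= !inE xD/= subrr mul0r subr_ge0 avoid_le1.
  by rewrite avoid_in ?inE ?xD// subr0 mul1r add0n dD.
have [xD|xD] := boolP (x \in D); last first.
  rewrite avoid_in ?inE ?xD// subr0 mul1r (le_trans (dD _ xD))//.
  by rewrite lerD2l lerN2 avoid_addl_le.
have [d0|d0] := leP 0 delta; last first.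
  apply: (@le_trans _ _ 0); last by rewrite subr_ge0 avoid_le1.
  by rewrite mulr_ge0_le0 ?subr_ge0 ?avoid_le1// ltW.
have [xA|xA] := boolP (x \in A).
  rewrite (avoid_in _ xA) subr0 mulr_ile1// ?subr_ge0 ?avoid_le1//.
  by rewrite gerBl avoid_ge0.
rewrite avoidS_notin ?inE ?xD// addSn (avoidS_notin _ xA).
have -> : 1 - step (avoid A (s + T)) x =
    step (fun z => -1 * avoid A (s + T) z + 1) x by rewrite step_affine; ring.
have -> : (1 - step (avoid (~: D) s) x) * delta =
    step (fun z => - delta * avoid (~: D) s z + delta) x.
  by rewrite step_affine; ring.
by apply: step_mono => z; have := IH z; lra.
Qed.

Lemma visitsS_le A n x : visits A n.+1 x <= visits A n x + 1.
Proof.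
elim: n x => [|n IH] x.
  by rewrite /= step_cst addr0 add0r lern1 leq_b1.
rewrite -[leLHS]/(_ + step (visits A n.+1) x) /= -addrA lerD2l.
rewrite -[step _ x in leRHS]mul1r -step_affine.
by apply: step_mono => z; rewrite mul1r IH.
Qed.

Lemma visits_add_le A s T x : visits A (s + T) x <= s%:R + visits A T x.
Proof.
elim: s => [|s IH]; first by rewrite add0r.
by rewrite addSn (le_trans (visitsS_le _ _ _))// -natr1; lra.
Qed.

Lemma visits_le A n x : visits A n x <= n%:R.
Proof. by have := visits_add_le A n 0 x; rewrite addn0/= addr0. Qed.

(** There are at most [n] visits, and none at all unless [A] is hit. *)
Lemma visits_le_hit A n x : visits A n x <= n%:R * (1 - avoid A n x).
Proof.
elim: n x => [|n IH] x; first by rewrite mul0r.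
have [xA|xA] := boolP (x \in A).
  by rewrite avoid_in// subr0 mulr1 visits_le.
rewrite avoidS_notin//= (negPf xA) add0r.
apply: (@le_trans _ _ (n%:R * (1 - step (avoid A n) x))).
  have -> : n%:R * (1 - step (avoid A n) x) =
    step (fun z => - n%:R * avoid A n z + n%:R) x by rewrite step_affine; ring.
  by apply: step_mono => z; have := IH z; lra.
rewrite ler_wpM2r ?ler_nat// subr_ge0 -(step_cst 1 x).
by apply: step_mono => z; exact: avoid_le1.
Qed.

(* Once D is entered, A is hit within time T with probability at most delta, so
   the last T steps contribute many visits only if D was avoided up to time s. *)
Lemma visits_le_avoid A D (delta : R) s T x : 0 <= delta ->
    (forall z, z \in D -> 1 - avoid A T z <= delta) ->
  visits A (s + T) x <= s%:R + T%:R * (avoid D s x + delta).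
Proof.
move=> d0 Dd; elim: s x => [|s IH] x; have [xD|xD] := boolP (x \in D).
- rewrite avoid_in// !add0r add0n (le_trans (visits_le_hit _ _ _))//.
  by rewrite ler_wpM2l ?Dd.
- rewrite /= xD add0r add0n (le_trans (visits_le _ _ _))// ler_peMr//.
  by rewrite lerDl.
- rewrite avoid_in// add0r (le_trans (visits_add_le _ _ _ _))// lerD2l.
  by rewrite (le_trans (visits_le_hit _ _ _))// ler_wpM2l ?Dd.
- rewrite addSn avoidS_notin//=.
  have xA : (x \in A)%:R <= 1 :> R by rewrite lern1 leq_b1.
  have : step (visits A (s + T)) x <=
      step (fun z => T%:R * avoid D s z + (s%:R + T%:R * delta)) x.
    by apply: step_mono => z; have := IH z; lra.
  by rewrite step_affine -natr1; lra.
Qed.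

(** A chain started from [pi] has law [pi] at every time, so each of the [n] times contributes the
    mass of [A]. *)
Lemma sum_stationary_visits (pi : S -> R) A n : stationary_distribution P pi ->
  \sum_x pi x * visits A n x = n%:R * \sum_(a in A) pi a.
Proof.
move=> [_ _ piP]; elim: n => [|n IH].
  by rewrite mul0r big1// => x _; rewrite mulr0.
rewrite -natr1 mulrDl mul1r -IH addrC; under eq_bigr do rewrite /= mulrDr.
rewrite big_split/=; congr (_ + _).
  rewrite [RHS]big_mkcond/=; apply: eq_bigr => x _.
  by case: (x \in A); rewrite ?mulr1 ?mulr0.
under eq_bigr do rewrite mulr_sumr; rewrite exchange_big/=.
by apply: eq_bigr => y _; rewrite -piP mulr_suml; apply: eq_bigr => x _; ring.
Qed.

(** Markov property at time [L.+1]: the chain must first survive up to time [L], and [K] bounds the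
    remaining sum from wherever it then stands. *)
Lemma sum_avoid_shift B (K : R) N L x : 0 <= K ->
    (forall z, \sum_(k < N) avoid B k z <= K) ->
  \sum_(k < N) avoid B (L.+1 + k) x <= avoid B L x * K.
Proof.
move=> K0 HK; elim: L x => [|L IH] x; have [xB|xB] := boolP (x \in B).
- by rewrite avoid_in// mul0r big1// => k _; rewrite avoid_in.
- under eq_bigr do rewrite add1n avoidS_notin//.
  rewrite -(step_sum _ (avoid B)) /= xB mul1r -[leRHS](step_cst K x).
  exact: step_mono.
- by rewrite avoid_in// mul0r big1// => k _; rewrite avoid_in.
- under eq_bigr do rewrite addSn avoidS_notin//.
  rewrite -(step_sum _ (fun k => avoid B (L.+1 + k))) avoidS_notin//.
  rewrite mulrC -[leRHS]addr0 -step_affine.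
  by apply: step_mono => z; have := IH z; lra.
Qed.

(** Each block of [L.+1] times is survived with probability at most [1 - e], which gives geometric
    decay over blocks. *)
Lemma sum_avoid_le B (e : R) L N x : 0 < e ->
    (forall z, avoid B L z <= 1 - e) ->
  \sum_(k < N) avoid B k x <= L.+1%:R / e.
Proof.
move=> e0 HL; have K0 : 0 <= L.+1%:R / e by rewrite divr_ge0// ltW.
(* The first block contributes at most [L.+1] and the others at most [(1 - e) * K], where
   [K = L.+1 / e] solves [K = L.+1 + (1 - e) * K]. *)
have blocks q z : \sum_(k < q * L.+1) avoid B k z <= L.+1%:R / e.
  elim: q z => [|q IH] z; first by rewrite big_ord0.
  rewrite mulSn big_split_ord/=.
  have := sum_avoid_shift L z K0 IH.
  have h1 : \sum_(k < L.+1) avoid B k z <= L.+1%:R.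
    rewrite -[in leRHS](card_ord L.+1) -sum1_card natr_sum.
    by apply: ler_sum => k _; exact: avoid_le1.
  have : avoid B L z * (L.+1%:R / e) <= (1 - e) * (L.+1%:R / e).
    by rewrite ler_wpM2r.
  have : e * (L.+1%:R / e) = L.+1%:R by field; rewrite gt_eqF.
  lra.
apply: le_trans (blocks N x).
rewrite mulnS big_split_ord/= lerDl.
by apply: sumr_ge0 => k _; exact: avoid_ge0.
Qed.

End TransitionOperator.

(** * Path events and their avoidance probabilities *)

Section PathProbabilities.
Context {R : realType} {S : finType} {d : measure_display}
  {Omega : measurableType d}.
Implicit Types (P : S -> S -> R) (mu : probability Omega R)
  (X Y : nat -> Omega -> S) (A B D : {set S}).

Definition stays_out X B n : set Omega :=
  [set o | forall i, (i <= n)%N -> X i o \notin B].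

Lemma measurable_preim X (E : pred S) n :
  (forall n s, measurable (X n @^-1` [set s])) ->
  measurable [set o | E (X n o)].
Proof.
move=> mX; rewrite (_ : [set _ | _] =
    \bigcup_(s in [set s | E s]) X n @^-1` [set s]).
  by apply: fin_bigcup_measurable => // s _; exact: mX.
apply/seteqP; split => o /=; first by move=> Eo; exists (X n o).
by move=> [s Es /= ->].
Qed.

Lemma measurable_stays_out X B n :
  (forall n s, measurable (X n @^-1` [set s])) -> measurable (stays_out X B n).
Proof.
move=> mX; rewrite (_ : stays_out X B n =
    \bigcap_(i in `I_n.+1) [set o | X i o \notin B]).
  apply: fin_bigcap_measurable => // i _.
  exact: (@measurable_preim X (fun s => s \notin B)).
by apply/seteqP; split => o /= h i; move/(_ i): h.
Qed.

Lemma measurable_cylinder X w n :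
  (forall n s, measurable (X n @^-1` [set s])) -> measurable (cylinder X n w).
Proof.
move=> mX; rewrite (_ : cylinder X n w =
    \bigcap_(i in `I_n.+1) X i @^-1` [set w i]).
  by apply: fin_bigcap_measurable => // i _; exact: mX.
by apply/seteqP; split => o /= h i; move/(_ i): h.
Qed.

Lemma measure_partition (mu : probability Omega R) (f : Omega -> S) E :
  (forall s, measurable (f @^-1` [set s])) -> measurable E ->
  (mu E = \sum_(s : S) mu (E `&` f @^-1` [set s]))%E.
Proof.
move=> mf mE.
have EU : E = \bigcup_(s in [set: S]) (E `&` f @^-1` [set s]).
  apply/seteqP; split => o; first by move=> Eo; exists (f o).
  by move=> [s _ []].
rewrite {1}EU measure_fin_bigcup//.
- rewrite (fsbigE (enum S)) ?enum_uniq//; last first.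
    by move=> s _; rewrite mem_enum.
  by rewrite big_enum_cond/=; apply: eq_bigl => s; rewrite in_setT.
- exact: finite_finset.
- by move=> s t _ _ [u [[_ /= <-] [_ /= <-]]].
- by move=> s _; exact: measurableI.
Qed.

Definition set_nth_path (w : nat -> S) n s : nat -> S :=
  fun i => if i == n then s else w i.

(* The statement is generalised to an arbitrary initial segment so that the
   Markov property applies at each step of the induction. *)
Lemma cylinder_stays_out mu P x X B m n w : markov_chain mu P x X ->
  mu (cylinder X m w `&` [set o | forall i, (i <= n)%N -> X (m + i)%N o \notin B])
  = (mu (cylinder X m w) * (avoid P B n (w m))%:E)%E.
Proof.
move=> [mX _ markovX].
have mout n' m' : measurable
    [set o | forall i, (i <= n')%N -> X (m' + i)%N o \notin B].
  exact: (@measurable_stays_out (fun i => X (m' + i)%N)).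
have mcyl := measurable_cylinder _ _ mX.
elim: n m w => [|n IH] m w; have [wB|wB] := boolP (w m \in B).
- rewrite avoid_in// mule0 (_ : _ `&` _ = set0) ?measure0//.
  apply/seteqP; split => // o [/= /(_ m (leqnn m)) Xw /(_ 0%N isT)].
  by rewrite addn0 Xw wB.
- rewrite /= wB mule1; congr (mu _); apply/seteqP; split => o; first by case.
  move=> Xw; split=> // i; rewrite leqn0 => /eqP ->.
  by rewrite addn0 (Xw m (leqnn m)).
- rewrite avoid_in// mule0 (_ : _ `&` _ = set0) ?measure0//.
  apply/seteqP; split => // o [/= /(_ m (leqnn m)) Xw /(_ 0%N isT)].
  by rewrite addn0 Xw wB.
- rewrite (measure_partition _ (mX m.+1)); last exact: measurableI.
  have muE : mu (cylinder X m w) = (fine (mu (cylinder X m w)))%:E.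
    by rewrite fineK// fin_num_measure.
  rewrite muE -EFinM avoidS_notin//= /step mulr_sumr -sumEFin.
  (* The path [v] prolongs [w] by the state [s] at time [m.+1], so the induction hypothesis applies
     to its longer cylinder. *)
  apply: eq_bigr => s _; pose v := set_nth_path w m.+1 s.
  have vE i : (i <= m)%N -> v i = w i.
    by move=> im; rewrite /v /set_nth_path ltn_eqF.
  have vm : v m.+1 = s by rewrite /v /set_nth_path eqxx.
  have cylE : cylinder X m w = cylinder X m v.
    by apply/seteqP; split => o Xo i im; rewrite Xo// vE.
  transitivity (mu (cylinder X m.+1 v `&`
      [set o | forall i, (i <= n)%N -> X (m.+1 + i)%N o \notin B])).
    congr (mu _); apply/seteqP; split => o /=.
      move=> [[Xw out] Xs]; split.
        move=> i; rewrite leq_eqVlt => /predU1P[->|im]; first by rewrite vm.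
        by rewrite vE// Xw.
      by move=> i im; rewrite addSnnS out.
    move=> [Xw out]; split; last by rewrite Xw// vm.
    split => [i im|[_|i im]]; first by rewrite Xw ?vE// leqW.
      by rewrite addn0 Xw// vE.
    by rewrite -addSnnS out.
  by rewrite IH markovX -cylE muE vm vE// -!EFinM mulrA.
Qed.

Lemma probability_stays_out mu P x X B n : markov_chain mu P x X ->
  mu (stays_out X B n) = (avoid P B n x)%:E.
Proof.
move=> MX; have [mX X0 _] := MX.
rewrite (measure_partition _ (mX 0%N)); last exact: measurable_stays_out.
have cylE s : X 0%N @^-1` [set s] = cylinder X 0 (fun=> s).
  apply/seteqP; split => o /=; last exact.
  by move=> Xs i; rewrite leqn0 => /eqP ->.
under eq_bigr => s _.
  rewrite setIC cylE.
  rewrite [stays_out _ _ _]/(stays_out (fun i => X (0 + i)%N) B n).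
  rewrite (cylinder_stays_out _ _ _ _ MX)/=; over.
(* Only the initial state [x] contributes, the others having probability zero. *)
rewrite (bigD1 x)//= -cylE X0 mul1e big1 ?adde0// => s sx.
rewrite -cylE (_ : mu _ = 0%E) ?mul0e//.
apply/eqP; rewrite eq_le measure_ge0 andbT.
have : (mu (X 0%N @^-1` [set s]) <= mu (~` (X 0%N @^-1` [set x])))%E.
  apply: le_measure; rewrite ?inE//; first exact: measurableC.
  by move=> o /= -> /eqP; rewrite (negPf sx).
by rewrite probability_setC// X0 subee.
Qed.

(* Unlike [ge0_le_integral], no measurability is assumed. *)
Lemma ge0_integral_mono mu (f g : Omega -> \bar R) :
  (forall o, (0 <= f o)%E) -> (forall o, (f o <= g o)%E) ->
  (\int[mu]_o f o <= \int[mu]_o g o)%E.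
Proof.
move=> f0 fg; have g0 o : (0 <= g o)%E by exact: le_trans (fg o).
rewrite !ge0_integralTE//; apply: ereal_sup_le => _ [h hf <-].
by exists h => //= o; exact: le_trans (fg o).
Qed.

(** * Expected hitting and intersection times *)

Lemma hitting_time_ge0 X A o : (0 <= hitting_time (R := R) X A o)%E.
Proof. by apply: le_ereal_inf_tmp => _ [t _ <-]; rewrite lee_fin. Qed.

(** The series counts the times by which [A] has not yet been hit: at least [m] of them if [m] is
    the first hit, infinitely many if there is none. *)
Lemma hitting_time_le_series X A o :
  (hitting_time (R := R) X A o <= \sum_(n <oo) (\1_(stays_out X A n) o)%:E)%E.
Proof.
have ge0 n : (0 <= (\1_(stays_out X A n) o)%:E :> \bar R)%E by rewrite lee_fin.
have outE n : (forall i, (i <= n)%N -> X i o \notin A) ->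
    (n.+1%:R%:E <= \sum_(0 <= k < n.+1) (\1_(stays_out X A k) o)%:E :> \bar R)%E.
  move=> out; rewrite (eq_big_nat _ _ (F2 := fun=> 1%:E)).
    by rewrite sumEFin sumr_const_nat subn0 lee_fin.
  move=> k kn; rewrite indicE mem_set// => i ik; apply: out.
  exact: leq_trans ik _.
have [[t XA]|none] := pselect (exists t, X t o \in A); last first.
  suff -> : (\sum_(n <oo) (\1_(stays_out X A n) o)%:E = +oo :> \bar R)%E.
    by rewrite leey.
  apply/eqyP => M M0.
  apply: (@le_trans _ _
    (\sum_(0 <= k < (Num.truncn M).+1) (\1_(stays_out X A k) o)%:E)%E).
    apply: le_trans (outE _ _); first by rewrite lee_fin ltW// truncnS_gt.
    by move=> i _; apply/negP => XA; apply: none; exists i.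
  exact: nneseries_lim_ge.
have exA : exists t, X t o \in A by exists t.
case: (ex_minnP exA) => m mA minm.
apply: ge_ereal_inf; exists m%:R%:E; first by exists m.
case: m mA minm => [|m] mA minm; first exact: nneseries_ge0.
apply: le_trans (outE m _) _; last exact: nneseries_lim_ge.
by move=> i im; apply/negP => /minm; rewrite leqNgt ltnS im.
Qed.

Lemma integral_hitting_time_le mu P x X A (K : R) :
  stochastic P -> markov_chain mu P x X ->
  (forall N, \sum_(k < N) avoid P A k x <= K) ->
  (\int[mu]_o hitting_time X A o <= K%:E)%E.
Proof.
move=> stochP MX HK; have [mX _ _] := MX.
apply: (@le_trans _ _ (\int[mu]_o \sum_(n <oo) (\1_(stays_out X A n) o)%:E)%E).
  apply: ge0_integral_mono => o; first exact: hitting_time_ge0.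
  exact: hitting_time_le_series.
rewrite integral_nneseries//; last first.
  by move=> n; apply/measurable_EFinP/measurable_indic/measurable_stays_out.
rewrite (eq_eseriesr (g := fun n => (avoid P A n x)%:E)); last first.
  move=> n _; rewrite integral_indic//; last exact: measurable_stays_out.
  by rewrite setIT; exact: probability_stays_out.
apply: lime_le => [|].
  by apply: is_cvg_nneseries => n _ _; rewrite lee_fin avoid_ge0.
by apply: nearW => N; rewrite sumEFin lee_fin big_mkord.
Qed.

(** If [Y] stays inside [D] and [Z] outside it through time [n], their ranges are disjoint and the
    intersection time is at least [n.+1]. A union bound on the complements bounds the probability of
    this event from below, and Markov's inequality concludes. *)
Lemma avoid_le_intersection_time mu P x y Y Z D n :
  markov_chain mu P x Y -> markov_chain mu P y Z ->
  ((n.+1%:R * (avoid P (~: D) n x + avoid P D n y - 1))%:E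
     <= \int[mu]_o intersection_time Y Z o)%E.
Proof.
move=> MY MZ; have [mY _ _] := MY; have [mZ _ _] := MZ.
set E := stays_out Y (~: D) n `&` stays_out Z D n.
have mYD := measurable_stays_out (~: D) n mY.
have mZD := measurable_stays_out D n mZ.
have mE : measurable E by exact: measurableI.
have muE : ((avoid P (~: D) n x + avoid P D n y - 1)%:E <= mu E)%E.
  have : (mu (stays_out Y (~: D) n) <= mu E + mu (~` stays_out Z D n))%E.
    apply: le_trans (measureU2 _ mE (measurableC mZD)).
    apply: le_measure; rewrite ?inE//.
      by apply: measurableU => //; exact: measurableC.
    by rewrite /E setUIl setUv setIT; exact: subsetUl.
  rewrite probability_setC// (probability_stays_out _ _ MY).
  rewrite (probability_stays_out _ _ MZ).
  have -> : mu E = (fine (mu E))%:E by rewrite fineK// fin_num_measure.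
  by rewrite -EFinB -EFinD !lee_fin; lra.
apply: (@le_trans _ _ (\int[mu]_o (n.+1%:R%:E * (\1_E o)%:E))%E).
  rewrite ge0_integralZl_EFin//; last exact/measurable_EFinP/measurable_indic.
  by rewrite integral_indic// setIT EFinM lee_wpmul2l// lee_fin.
apply: ge0_integral_mono => o; first by rewrite mule_ge0// lee_fin.
have [oE|oE] := boolP (o \in E); last first.
  rewrite indicE (negPf oE) mule0; apply: le_ereal_inf_tmp => _ [t _ <-].
  by rewrite lee_fin.
rewrite indicE oE mule1; apply: le_ereal_inf_tmp.
move=> _ [t [s [/= [i it Yi] [j jt Zj]]] <-].
rewrite lee_fin ler_nat ltnNge; apply/negP => tn.
move: oE; rewrite inE => -[/(_ i) Yo /(_ j) Zo].
have := Zo (leq_trans (jt : (j <= t)%N) tn).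
have := Yo (leq_trans (it : (i <= t)%N) tn).
by rewrite Yi Zj inE negbK => ->.
Qed.

End PathProbabilities.

(** * Choice of scales and the contradiction with stationarity *)

Section HittingFromIntersection.
Context {R : realType} {S : finType} (P : S -> S -> R) (pi : S -> R).
Hypotheses (stochP : stochastic P) (statP : stationary_distribution P pi).

Lemma avoid_le_of_intersection (A : {set S}) (I : R) t x :
    1 / 8 <= \sum_(a in A) pi a -> (0 < t)%N -> 64 * I <= t.+1%:R ->
    (forall D y, t.+1%:R * (avoid P (~: D) t x + avoid P D t y - 1) <= I) ->
  avoid P A (t + 12 * t) x <= 1 - 1 / 64 / 64.
Proof.
move=> piA t0 It meet; rewrite leNgt; apply/negP => smallhit.
set T := (12 * t)%N in smallhit *.
pose D : {set S} := [set z | 1 - avoid P A T z <= 1 / 64]%SET.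
have d1 : (1 / 64 : R) <= 1 by lra.
(* Leaving [D] with probability above 1/64 would make [A] hit with probability above 1/64
   squared. *)
have stayD : 1 - 1 / 64 <= avoid P (~: D) t x.
  have outD z : z \notin D -> 1 / 64 <= 1 - avoid P A T z.
    by rewrite inE -ltNge => /ltW.
  by have := exit_hit stochP t x d1 outD; lra.
(* One 1/64 comes from [I / t.+1], the other from the chance that the chain from [x] leaves [D]. *)
have reachD y : avoid P D t y <= 1 / 32.
  have t1 : (0 : R) < t.+1%:R by rewrite ltr0n.
  have : t.+1%:R * (avoid P (~: D) t x + avoid P D t y - 1) <= t.+1%:R * (1 / 64).
    by apply: le_trans (meet D y) _; lra.
  by rewrite ler_pM2l// => ?; lra.
have visitsA y : visits P A (t + T) y <= t%:R + T%:R * (3 / 64).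
  apply: (@le_trans _ _ (t%:R + T%:R * (avoid P D t y + 1 / 64))).
    by apply: visits_le_avoid => // z; rewrite inE.
  by rewrite lerD2l ler_wpM2l//; have := reachD y; lra.
have [pi0 pi1 _] := statP.
set K := t%:R + T%:R * (3 / 64) in visitsA.
have : \sum_y pi y * visits P A (t + T) y <= K.
  rewrite (_ : K = \sum_y pi y * K); last by rewrite -mulr_suml pi1 mul1r.
  apply: ler_sum => y _.
  by rewrite ler_wpM2l.
rewrite (sum_stationary_visits _ _ statP).
have : (t + T)%:R * (1 / 8) <= (t + T)%:R * \sum_(a in A) pi a.
  by rewrite ler_wpM2l.
(* The visits are at most [t + 12 t * 3/64], that is 25/16 of [t], whereas stationarity demands 13/8
   of [t]. *)
have : (0 : R) < t%:R by rewrite ltr0n.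
rewrite /K /T natrD natrM; lra.
Qed.

Lemma sum_avoid_le_intersection (A : {set S}) (I : R) N x :
    1 / 8 <= \sum_(a in A) pi a ->
    (forall D n x y, n.+1%:R * (avoid P (~: D) n x + avoid P D n y - 1) <= I) ->
  \sum_(k < N) avoid P A k x <= 14 * 64 * 64 * 64 * I.
Proof.
move=> piA meet.
have I0 : 0 <= I.
  apply: le_trans (meet finset.set0 0%N x x).
  by rewrite /= !inE mul1r addrK.
(* If [I < 1], two distinct states, separated by a singleton [D] at time 0, would violate [meet];
   hence there is one state, it lies in [A], and the sum vanishes. *)
have [I1|I1] := leP 1 I; last first.
  have allx y : y = x.
    apply/eqP/negPn/negP => yx.
    have := meet [set x]%SET 0%N x y.
    by rewrite /= !inE eqxx yx mul1r addrK leNgt I1.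
  have [A0|[a aA]] := set_0Vmem A.
    by move: piA; rewrite A0 big_set0; lra.
  rewrite big1 ?mulr_ge0// => k _.
  by rewrite avoid_in// -(allx a).
pose t := Num.truncn (64 * I).
have tI : t%:R <= 64 * I by rewrite Num.Theory.truncn_le; lra.
have It : 64 * I < t.+1%:R by exact: truncnS_gt.
have t0 : (0 < t)%N.
  by rewrite -ltnS -(ltr_nat R); apply: lt_trans It; lra.
have := sum_avoid_le (e := 1 / 64 / 64) (L := (t + 12 * t)%N) (B := A) stochP.
move=> /(_ N x) bound; apply: le_trans (bound _ _) _.
- lra.
- by move=> z; apply: (@avoid_le_of_intersection _ I) => //; exact: ltW.
(* Here [13 t + 1] is at most [14 t], and [t] is at most [64 * I]; dividing by [e] gives the other
   two factors 64. *)
- rewrite -natr1 natrD natrM; lra.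
Qed.

End HittingFromIntersection.

Theorem theorem1p1 (R : realType) :
  exists C : R, 0 < C /\
  forall (S : finType) (P : S -> S -> R) (pi : S -> R),
    stochastic P -> irreducible P -> lazy_matrix P ->
    stationary_distribution P pi ->
  forall (d1 : measure_display) (Omega1 : measurableType d1)
         (Pr1 : S -> probability Omega1 R) (X : nat -> Omega1 -> S),
    (forall x, markov_chain (Pr1 x) P x X) ->
  forall (d2 : measure_display) (Omega2 : measurableType d2)
         (Pr2 : S -> S -> probability Omega2 R) (Y Z : nat -> Omega2 -> S),
    (forall x y, [/\ markov_chain (Pr2 x y) P x Y,
                     markov_chain (Pr2 x y) P y Z
                   & independent_processes (Pr2 x y) Y Z]) ->
  (tH Pr1 X pi <= C%:E * tI Pr2 Y Z)%E.
Proof.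
exists (14 * 64 * 64 * 64); split; first lra.
move=> S P pi stochP _ _ statP d1 Omega1 Pr1 X MX d2 Omega2 Pr2 Y Z MYZ.
have tI_ge D n x y :
    ((n.+1%:R * (avoid P (~: D) n x + avoid P D n y - 1))%:E <= tI Pr2 Y Z)%E.
  have [MY MZ _] := MYZ x y.
  apply: le_trans (avoid_le_intersection_time D n MY MZ) _.
  exact: (le_bigmax _ (fun xy => \int[Pr2 xy.1 xy.2]_o intersection_time Y Z o)%E
    (x, y)).
apply: bigmax_le => [|[x A] /= piA]; first exact: leNye.
(* Nonnegativity leaves [+oo] as the only infinite value, for which the bound is trivial. *)
have tI0 : (0 <= tI Pr2 Y Z)%E.
  apply: le_trans (tI_ge finset.set0 0%N x x).
  by rewrite lee_fin /= !inE mul1r addrK.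
have [tIfin|tIoo] := boolP (tI Pr2 Y Z \is a fin_num); last first.
  have -> : tI Pr2 Y Z = +oo%E.
    by apply/eqP; move: tIoo; rewrite ge0_fin_numE// -leNgt leye_eq.
  by rewrite mulry gtr0_sg ?mul1e ?leey//; lra.
rewrite -(fineK tIfin) -EFinM.
apply: integral_hitting_time_le (MX x) _ => // N.
apply: sum_avoid_le_intersection piA _ => // D n y z.
by rewrite -lee_fin fineK.
Qed.
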